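(* The off-shell Bethe vector $|\mu_1,\dots,\mu_m\rangle=T_{12}(\mu_1)\cdots T_{12}(\mu_m)|\mathbf w\rangle$ is an eigenvector of the transfer matrix $\widehat t(u)=T_{11}(u)+Q\,T_{22}(u)$ with eigenvalue $$\Lambda(u)=a(u)\prod_{j=1}^m\frac{u-\mu_j+1}{u-\mu_j}+Q\,d(u)\prod_{j=1}^m\frac{u-\mu_j-1}{u-\mu_j},$$ provided that all the Bethe roots $\mu_1,\dots,\mu_m$ are distinct and the following system of Bethe equations is satisfied: $$\frac{a(\mu_i)}{d(\mu_i)}=Q\prod_{j\ne i}^m\frac{\mu_i-\mu_j-1}{\mu_i-\mu_j+1},\qquad i=1,\dots,m.$$
   Context: Let $Q\in\mathbb{R}$, and let $w_1,\dots,w_n\in\mathbb{R}$ be deformation parameters, all nonzero. The local quantum Lax operators, whose entries are differential operators in the variables $x_1,\dots,x_n$, are $$\widehat L_i(u)=\begin{pmatrix} u-x_i\partial_{x_i} & x_i^{-1}(1-w_ix_i\partial_{x_i})\\ x_i(1+w_ix_i\partial_{x_i}) & w_i^2(u+x_i\partial_{x_i})\end{pmatrix}.$$ The monodromy matrix is $T(u)=\widehat L_n(u)\cdots\widehat L_1(u)=\begin{pmatrix}T_{11}(u)&T_{12}(u)\\ T_{21}(u)&T_{22}(u)\end{pmatrix}$. The pseudo-vacuum is the (formal) function $|\mathbf w\rangle=\prod_{i=1}^nx_i^{-1/w_i}$. It satisfies $T_{21}(u)|\mathbf w\rangle=0$, $T_{11}(u)|\mathbf w\rangle=a(u)|\mathbf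 w\rangle$ and $T_{22}(u)|\mathbf w\rangle=d(u)|\mathbf w\rangle$, where $$a(u)=\prod_{i=1}^n(u+w_i^{-1}),\qquad d(u)=\prod_{i=1}^nw_i(w_iu-1).$$ The parameters $\mu_1,\dots,\mu_m$ are called Bethe roots.
   Formalization: ''Is an eigenvector'' is stated as the equation t(u)|μ⟩ = Λ(u)|μ⟩ without claiming |μ⟩ ≠ 0, since the Bethe vector can vanish (n=1, w=−2, Q=1/4, μ=±4/5); u ≠ μ_j and nonzero denominators in the Bethe equations are made explicit. *)

(* Defs.v *)
From HB Require Import structures.
From mathcomp Require Import all_boot all_order all_algebra.
From mathcomp Require Import reals complex.
From mathcomp Require Import finmap monalg.

Set Implicit Arguments.
Unset Strict Implicit.
Unset Printing Implicit Defensive.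

Import Order.TTheory GRing.Theory Num.Theory.

Local Open Scope ring_scope.
Local Open Scope complex_scope.

(* Formal functions of x_1, ..., x_n: finite complex linear combinations of the
   monomials x^k = x_1^(k_1) ... x_n^(k_n), where the exponents k_i are real
   numbers.  The monomial c x^k is << c *g k >>.  Sites are indexed by 'I_n,
   that is from 0 to n - 1. *)
Notation formal_fun R n := ({malg (complex R) ['rV[R]_n]}).

Definition operator (R : realType) (n : nat) := formal_fun R n -> formal_fun R n.

Section Operators.
Context {R : realType} {n : nat}.
Implicit Types (i : 'I_n) (f : formal_fun R n) (w : 'I_n -> R) (u : R[i]).

(* Multiplication by the monomial x^e. *)
Definition mul_mon (e : 'rV[R]_n) : operator R n :=
  fun f => \sum_(k <- msupp f) << f@_k *g k + e >>.

Definition mulx i : operator R n := mul_mon (delta_mx 0 i).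
Definition mulxV i : operator R n := mul_mon (- delta_mx 0 i).

(* The partial derivative with respect to x_i: x^k is sent to
   k_i x^(k - e_i). *)
Definition dx i : operator R n :=
  fun f => \sum_(k <- msupp f) << f@_k * (k 0 i)%:C *g k - delta_mx 0 i >>.

Definition euler i : operator R n := fun f => mulx i (dx i f).

(* 2 x 2 matrices whose entries are operators; the product of two entries is
   their composition. *)
Definition opmx (A B C D : operator R n) : 'M[operator R n]_2 :=
  \matrix_(a, b) if a == 0 then (if b == 0 then A else B)
                 else (if b == 0 then C else D).

Definition opmx1 : 'M[operator R n]_2 := opmx id (fun=> 0) (fun=> 0) id.

Definition opmx_mul (A B : 'M[operator R n]_2) : 'M[operator R n]_2 :=
  \matrix_(a, b) fun f => \sum_c A a c (B c b f).

Definition lax w i u : 'M[operator R n]_2 :=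
  opmx (fun f => u *: f - euler i f)
       (fun f => mulxV i (f - (w i)%:C *: euler i f))
       (fun f => mulx i (f + (w i)%:C *: euler i f))
       (fun f => (w i)%:C ^+ 2 *: (u *: f + euler i f)).

(* The site with the largest index is the leftmost factor. *)
Definition monodromy w u : 'M[operator R n]_2 :=
  \big[opmx_mul/opmx1]_(i < n) lax w (rev_ord i) u.

Definition T11 w u : operator R n := monodromy w u 0 0.
Definition T12 w u : operator R n := monodromy w u 0 1.
Definition T21 w u : operator R n := monodromy w u 1 0.
Definition T22 w u : operator R n := monodromy w u 1 1.

Definition transfer (Q : R) w u : operator R n :=
  fun f => T11 w u f + Q%:C *: T22 w u f.

Definition pseudo_vacuum w : formal_fun R n := << \row_i - (w i)^-1 >>.

Definition bethe_vector w (m : nat) (mu : 'I_m -> R[i]) : formal_fun R n :=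
  foldr (fun j => T12 w (mu j)) (pseudo_vacuum w) (enum 'I_m).

Definition vac_a w u : R[i] := \prod_(i < n) (u + ((w i)%:C)^-1).

Definition vac_d w u : R[i] := \prod_(i < n) ((w i)%:C * ((w i)%:C * u - 1)).

Definition bethe_eigenvalue (Q : R) w (m : nat) (mu : 'I_m -> R[i]) u : R[i] :=
  vac_a w u * \prod_(j < m) ((u - mu j + 1) / (u - mu j)) +
  Q%:C * vac_d w u * \prod_(j < m) ((u - mu j - 1) / (u - mu j)).

(* Since x / 0 = 0 here, the requirement that the fractions in the equations
   make sense is spelled out. *)
Definition bethe_equations (Q : R) w (m : nat) (mu : 'I_m -> R[i]) : Prop :=
  forall i : 'I_m,
    [/\ vac_d w (mu i) != 0,
        forall j : 'I_m, j != i -> mu i - mu j + 1 != 0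
      & vac_a w (mu i) / vac_d w (mu i) =
        Q%:C * \prod_(j < m | j != i)
                 ((mu i - mu j - 1) / (mu i - mu j + 1))].

End Operators.

(* Main.v *)
(* Each Lax matrix satisfies the quadratic relation [rtt] of the rational
   R-matrix, which can be read off from its action on monomials.  Entries at
   different sites commute, so [rtt] passes to products, hence to the monodromy
   matrix.  It yields T12(u) T12(v) = T12(v) T12(u) and the exchange relations
   of T11(u) and T22(u) with T12(v).  Moving T11(u) and T22(u) through the
   product of the T12(mu_j) by induction gives the eigenvalue term and, for each
   i, an unwanted vector in which T12(mu_i) is replaced by T12(u); its
   coefficient vanishes by the i-th Bethe equation. *)

From HB Require Import structures.
Require Import Defs.
From mathcomp Require Import all_boot all_order all_algebra.
From mathcomp Require Import reals complex.
From mathcomp Require Import finmap monalg.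
From mathcomp Require Import ring.

Set Implicit Arguments.
Unset Strict Implicit.
Unset Printing Implicit Defensive.

Import GRing.Theory.

Local Open Scope ring_scope.
Local Open Scope complex_scope.

(** * Linearity rules for maps given as bare functions with a proof of linearity *)

Section LinearPredicate.
Variables (K : pzRingType) (V : lmodType K) (g : V -> V).
Hypothesis g_linear : linear g.

Let G : {linear V -> V} := HB.pack g (GRing.isLinear.Build _ _ _ _ g g_linear).

Lemma linear_predB x y : g (x - y) = g x - g y.
Proof. exact: (raddfB G). Qed.

Lemma linear_pred0 : g 0 = 0.
Proof. exact: (raddf0 G). Qed.

Lemma linear_predZ a x : g (a *: x) = a *: g x.
Proof. exact: (linearZ_LR G). Qed.

Lemma linear_pred_sum I (r : seq I) P F :
  g (\sum_(i <- r | P i) F i) = \sum_(i <- r | P i) g (F i).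
Proof. exact: (raddf_sum G). Qed.

End LinearPredicate.

(** * Moving a diagonal entry through a product of creation operators *)

Section OffShell.
Variables (K : fieldType) (V : lmodType K) (eps : K).
Variables (X B : K -> V -> V) (x : K -> K) (vac : V).
Hypothesis B_linear : forall u, linear (B u).
Hypothesis BC : forall u v y, B u (B v y) = B v (B u y).
Hypothesis XB : forall u v y, u != v ->
  X u (B v y) = ((u - v + eps) / (u - v)) *: B v (X u y)
                - (eps / (u - v)) *: B u (X v y).
Hypothesis X_vac : forall u, X u vac = x u *: vac.

(** The vector with [B z] replaced by [B u] arises in two ways: [X u] passes [B v] and is then
    exchanged with [B z], or it is first exchanged with [B v] and the resulting [X v] with [B z].
    The two coefficients add up to the one with the factor of [v] included. *)
Lemma unwanted_coef u v z : u != v -> u != z -> v != z ->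
  (u - v + eps) / (u - v) * (eps / (u - z)) - eps / (u - v) * (eps / (v - z)) =
  eps / (u - z) * ((z - v + eps) / (z - v)).
Proof.
move=> uv uz vz; have zv : z != v by rewrite eq_sym.
by field; rewrite !subr_eq0 uv uz vz zv.
Qed.

(* [eps] is 1 for [T11] and -1 for [T22]. *)
Lemma off_shell_action (s : seq K) u : uniq s -> u \notin s ->
  X u (foldr B vac s) =
    (x u * \prod_(v <- s) ((u - v + eps) / (u - v))) *: foldr B vac s
    - \sum_(v <- s) (eps / (u - v) *
        (x v * \prod_(z <- s | z != v) ((v - z + eps) / (v - z))))
        *: B u (foldr B vac (rem v s)).
Proof.
elim: s u => [|v s IHs] u /=.
  by rewrite !big_nil X_vac mulr1 subr0.
move=> /andP[vNs s_uniq]; rewrite inE negb_or => /andP[neq_uv uNs].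
rewrite XB // !IHs // !(linear_predB (B_linear _)) !(linear_predZ (B_linear _)).
rewrite !(linear_pred_sum (B_linear _)) 3!big_cons eqxx /=.
have -> : \prod_(z <- s | z != v) ((v - z + eps) / (v - z)) =
          \prod_(z <- s) ((v - z + eps) / (v - z)).
  rewrite big_seq_cond [RHS]big_seq; apply: eq_bigl => z.
  by case: (boolP (z \in s)) => //= zs; apply: contraNneq vNs => <-.
rewrite !scalerBr !scalerA opprB opprD addrACA -[LHS]addrA.
congr (_ + _); first by rewrite mulrCA.
(* The leading term of [X v] is the summand of the root [v]; the two remaining sums are combined
   root by root. *)
rewrite addrA [RHS]addrC; congr (_ - _); apply: oppr_inj; rewrite opprB opprK.
rewrite !scaler_sumr -sumrB; apply: eq_big_seq => z zs.
have neq_vz : v != z by apply: contraNneq vNs => ->.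
have neq_uz : u != z by apply: contraNneq uNs => ->.
rewrite big_cons neq_vz (negPf neq_vz) /= !(linear_predZ (B_linear _)) !scalerA.
rewrite (BC v u) -scalerBl; congr (_ *: _).
by rewrite !(mulrA _ _ (_ * _)) -mulrBl unwanted_coef //; ring.
Qed.

End OffShell.

(** * Solving commutator equations for exchange relations *)

Section CommutatorEquations.
Variables (K : fieldType) (V : lmodType K).
Implicit Types (u v : K) (p q : V).

(** One equation alone leaves the case [u - v = 1] open. The two left sides are equal, so [p - q]
    equals its own opposite. *)
Lemma eq_from_commutators u v p q : 2%:R != 0 :> K ->
  (u - v) *: (p - q) = p - q -> (v - u) *: (q - p) = q - p -> p = q.
Proof.
move=> two_neq0 E1 E2; apply/eqP; rewrite -subr_eq0.
have {}E2 : (u - v) *: (p - q) = - (p - q).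
  by rewrite opprB -E2 -[v - u]opprB scaleNr -scalerN opprB.
have /eqP : 2%:R *: (p - q) = 0 by rewrite scaler_nat mulr2n -{1}E1 E2 addNr.
by rewrite scaler_eq0 (negPf two_neq0).
Qed.

Lemma exchange_from_commutator u v eps p q r : u != v ->
  (u - v) *: (p - q) = eps *: (q - r) ->
  p = ((u - v + eps) / (u - v)) *: q - (eps / (u - v)) *: r.
Proof.
rewrite -subr_eq0 => uv E; have /(congr1 ( *:%R (u - v)^-1)) := E.
rewrite !scalerA mulVf // scale1r => /eqP; rewrite subr_eq => /eqP ->.
rewrite scalerBr mulrDl divff // scalerDl scale1r [eps / _]mulrC.
by rewrite addrC addrA.
Qed.

Lemma exchange_from_opp_commutator u v p q r : u != v ->
  (v - u) *: (q - p) = q - r ->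
  p = ((u - v + 1) / (u - v)) *: q - (1 / (u - v)) *: r.
Proof.
move=> uv E; apply: exchange_from_commutator => //.
by rewrite scale1r -E -[v - u]opprB scaleNr -scalerN opprB.
Qed.

Lemma exchange_from_neg_commutator u v p q r : u != v ->
  (u - v) *: (p - q) = r - q ->
  p = ((u - v + -1) / (u - v)) *: q - (-1 / (u - v)) *: r.
Proof.
by move=> uv E; apply: exchange_from_commutator; rewrite // scaleN1r opprB.
Qed.

End CommutatorEquations.

(** * The abstract algebraic Bethe ansatz *)

Section AlgebraicBetheAnsatz.
Variables (K : fieldType) (V : lmodType K) (q : K).
Variables (A B D : K -> V -> V) (a d : K -> K) (vac : V).
Hypothesis B_linear : forall u, linear (B u).
Hypothesis BC : forall u v y, B u (B v y) = B v (B u y).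
Hypothesis AB : forall u v y, u != v ->
  A u (B v y) = ((u - v + 1) / (u - v)) *: B v (A u y)
                - (1 / (u - v)) *: B u (A v y).
Hypothesis DB : forall u v y, u != v ->
  D u (B v y) = ((u - v + -1) / (u - v)) *: B v (D u y)
                - (-1 / (u - v)) *: B u (D v y).
Hypothesis A_vac : forall u, A u vac = a u *: vac.
Hypothesis D_vac : forall u, D u vac = d u *: vac.

Lemma algebraic_bethe_ansatz (s : seq K) u : uniq s -> u \notin s ->
  (forall v, v \in s ->
    a v * \prod_(z <- s | z != v) ((v - z + 1) / (v - z)) =
    q * (d v * \prod_(z <- s | z != v) ((v - z + -1) / (v - z)))) ->
  A u (foldr B vac s) + q *: D u (foldr B vac s) =
  (a u * \prod_(z <- s) ((u - z + 1) / (u - z)) +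
   q * d u * \prod_(z <- s) ((u - z - 1) / (u - z))) *: foldr B vac s.
Proof.
move=> s_uniq us bethe.
rewrite (off_shell_action B_linear BC AB A_vac) //.
rewrite (off_shell_action B_linear BC DB D_vac) //.
rewrite scalerBr scalerA addrACA -scalerDl mulrA -opprD.
(* [A] and [D] produce the same unwanted vectors, with opposite prefactors [1 / (u - v)] and
   [-1 / (u - v)], so the Bethe equation at [v] cancels them. *)
rewrite scaler_sumr -big_split [X in _ - X]big1_seq ?subr0 //= => v vs.
rewrite scalerA -scalerDl bethe //.
by rewrite [X in X *: _](_ : _ = 0) ?scale0r //; ring.
Qed.

End AlgebraicBetheAnsatz.

Lemma ord2 (P : 'I_2 -> Prop) : P 0 -> P 1 -> forall a, P a.
Proof.
move=> P0 P1 [[|[|//]] lt_a2].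
  by rewrite (_ : Ordinal _ = 0) //; apply: val_inj.
by rewrite (_ : Ordinal _ = 1) //; apply: val_inj.
Qed.

(* The relation R(u - v) T_1(u) T_2(v) = T_2(v) T_1(u) R(u - v) for the rational
   R-matrix R(u) = u - P, written entrywise. *)
Definition rtt (R : realType) (n : nat) (T : R[i] -> 'M[operator R n]_2) :=
  forall (u v : R[i]) (a b c d : 'I_2) (f : formal_fun R n),
  (u - v) *: (T u a b (T v c d f) - T v c d (T u a b f)) =
  T u c b (T v a d f) - T v c b (T u a d f).

(** * Lax matrices on coefficients of monomials *)

Section Coefficients.
Variables (R : realType) (n : nat).
Implicit Types (f : {malg R[i]['rV[R]_n]}) (k e : 'rV[R]_n) (i j : 'I_n).

(** Translation by [e] is injective, so only the monomial [k - e] contributes; if it lies outside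
    the support, both sides vanish. This covers [mul_mon] and [dx] alike. *)
Lemma mcoeff_shift_sum (c : 'rV[R]_n -> R[i]) e f k :
  (\sum_(k' <- msupp f) << f@_k' * c k' *g k' + e >>)@_k =
  f@_(k - e) * c (k - e).
Proof.
rewrite raddf_sum /=.
under eq_bigr => k' _ do rewrite mcoeffU eq_sym -subr_eq.
case: msuppP => [kf|kf].
  rewrite (bigD1_seq (k - e)) //=; last exact: fset_uniq.
  rewrite [_ == _]eqtype.eqxx mulr1n big1 ?addr0 // => k' neq.
  by rewrite eq_sym (negPf neq).
rewrite mul0r big_seq big1 // => k' k'f.
by case: eqP => // E; rewrite E k'f in kf.
Qed.

Lemma mcoeff_mul_mon e f k : (mul_mon e f)@_k = f@_(k - e).
Proof.
have -> : mul_mon e f = \sum_(k' <- msupp f) << f@_k' * 1 *g k' + e >>.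
  by apply: eq_bigr => k' _; rewrite mulr1.
by rewrite (mcoeff_shift_sum (fun=> 1)) mulr1.
Qed.

Lemma mcoeff_mulx i f k : (mulx i f)@_k = f@_(k - delta_mx 0 i).
Proof. exact: mcoeff_mul_mon. Qed.

Lemma mcoeff_mulxV i f k : (mulxV i f)@_k = f@_(k + delta_mx 0 i).
Proof. by rewrite mcoeff_mul_mon opprK. Qed.

Lemma mcoeff_euler i f k : (euler i f)@_k = (k 0 i)%:C * f@_k.
Proof.
rewrite mcoeff_mulx /dx (mcoeff_shift_sum (fun k => (k 0 i)%:C)).
by rewrite opprK subrK mulrC.
Qed.

Variable (w : 'I_n -> R).

Lemma laxE i u a b f : lax w i u a b f =
  if a == 0 then
    if b == 0 then u *: f - euler i f else mulxV i (f - (w i)%:C *: euler i f)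
  else if b == 0 then mulx i (f + (w i)%:C *: euler i f)
  else (w i)%:C ^+ 2 *: (u *: f + euler i f).
Proof. by rewrite mxE; case: (a == 0); case: (b == 0). Qed.

(* [lax w i u a b] multiplies the coefficient of x^k by a scalar depending on
   k_i, then translates the exponent by [- lax_shift i a b]; [lax_coef] is that
   scalar in terms of the exponent of the resulting monomial. *)
Definition lax_shift i (a b : 'I_2) : 'rV[R]_n :=
  (b%:R - a%:R) *: delta_mx 0 i.

Definition lax_coef i u (a b : 'I_2) (x : R[i]) : R[i] :=
  if a == 0 then
    if b == 0 then u - x else 1 - (w i)%:C * (x + 1)
  else if b == 0 then 1 + (w i)%:C * (x - 1) else (w i)%:C ^+ 2 * (u + x).

Lemma lax_shift_diag i a : lax_shift i a a = 0.
Proof. by rewrite /lax_shift subrr scale0r. Qed.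

Lemma lax_shift01 i : lax_shift i 0 1 = delta_mx 0 i.
Proof. by rewrite /lax_shift subr0 scale1r. Qed.

Lemma lax_shift10 i : lax_shift i 1 0 = - delta_mx 0 i.
Proof. by rewrite /lax_shift sub0r scaleN1r. Qed.

Lemma lax_coord_shift i a b k :
  ((k + lax_shift i a b) 0 i)%:C = (k 0 i)%:C + (b%:R - a%:R).
Proof. by rewrite !mxE !eqxx mulr1 rmorphD rmorphB !rmorph_nat. Qed.

Lemma lax_shiftD i a b c d :
  lax_shift i a b + lax_shift i c d =
  (b%:R + d%:R - (a%:R + c%:R)) *: delta_mx 0 i.
Proof. by rewrite /lax_shift -scalerDl opprD addrACA. Qed.

Lemma mcoeff_lax i u a b f k :
  (lax w i u a b f)@_k =
  lax_coef i u a b (k 0 i)%:C * f@_(k + lax_shift i a b).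
Proof.
(* [euler i f] is generalized because the unifier would otherwise unfold it. *)
elim/ord2: a; elim/ord2: b; rewrite /lax_coef /=.
- rewrite lax_shift_diag (addr0 k) laxE /=.
  move: (euler i f) (mcoeff_euler i f) => g gE.
  by rewrite mcoeffB mcoeffZ gE; ring.
- rewrite laxE /= mcoeff_mulxV -lax_shift01 mcoeffB mcoeffZ mcoeff_euler.
  by rewrite lax_coord_shift subr0 mulr1n; ring.
- rewrite laxE /= mcoeff_mulx -lax_shift10 mcoeffD mcoeffZ mcoeff_euler.
  by rewrite lax_coord_shift sub0r mulr1n; ring.
- rewrite lax_shift_diag (addr0 k) laxE /=.
  move: (euler i f) (mcoeff_euler i f) => g gE.
  by rewrite mcoeffZ mcoeffD mcoeffZ gE; ring.
Qed.

Lemma lax_linear i u a b : linear (lax w i u a b).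
Proof.
move: (lax w i u a b) (mcoeff_lax i u a b) => L mcoeff_L c f g.
by apply/malgP => k; rewrite !(mcoeffD, mcoeffZ, mcoeff_L); ring.
Qed.

(** The scalar at site [i] depends only on the exponent [k 0 i], which a shift at site [j] leaves
    unchanged. *)
Lemma lax_comm i j u v a b c d f : i != j ->
  lax w i u a b (lax w j v c d f) = lax w j v c d (lax w i u a b f).
Proof.
move=> ij; have ji : j != i by rewrite eq_sym.
apply/malgP => k; rewrite !mcoeff_lax.
rewrite !mxE (negPf ij) (negPf ji) !andbF !mulr0 !addr0.
by rewrite mulrCA -!addrA [lax_shift i a b + _]addrC.
Qed.

(** All four products translate exponents by the same vector, since its formula is symmetric in [b],
    [d] and in [a], [c]. What remains is a polynomial identity between scalars for each of the 16
    index choices. *)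
Lemma lax_rtt i : rtt (lax w i).
Proof.
move: (lax w i) (mcoeff_lax i) => L mcoeff_L u v a b c d f; apply/malgP => k.
rewrite !(mcoeffZ, mcoeffB, mcoeff_L).
rewrite !lax_coord_shift -!(addrA k) !lax_shiftD.
rewrite [d%:R + b%:R]addrC [c%:R + a%:R]addrC.
move: (f@_ _) => y; rewrite /lax_coef.
elim/ord2: a; elim/ord2: b; elim/ord2: c; elim/ord2: d => /=;
  rewrite ?mulr0n ?mulr1n; ring.
Qed.

End Coefficients.

(** * Products of two commuting solutions of [rtt] *)

Section Coproduct.
Variables (R : realType) (n : nat) (L T : R[i] -> 'M[operator R n]_2).
Hypothesis L_linear : forall u a b, linear (L u a b).
Hypothesis T_linear : forall u a b, linear (T u a b).
Hypothesis LT_comm : forall u v a b c d f,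
  L u a b (T v c d f) = T v c d (L u a b f).

Lemma opmx_mulE (A B : 'M[operator R n]_2) a b f :
  opmx_mul A B a b f = \sum_c A a c (B c b f).
Proof. by rewrite mxE. Qed.

Lemma opmx_mul_linear u a b : linear (opmx_mul (L u) (T u) a b).
Proof.
move=> x f g; rewrite !opmx_mulE scaler_sumr -big_split; apply: eq_bigr => c _.
by rewrite (T_linear _ _ _ x) (L_linear _ _ _ x).
Qed.

(** By [LT_comm] every product takes the order [L L T T]. Its commutator splits into one of the [L]
    factors and one of the [T] factors, and each is rewritten by its own [rtt]. *)
Lemma rtt_opmx_mul : rtt L -> rtt T -> rtt (fun u => opmx_mul (L u) (T u)).
Proof.
move=> L_rtt T_rtt u v a b c d f.
have mulE u1 u2 a1 b1 a2 b2 :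
    opmx_mul (L u1) (T u1) a1 b1 (opmx_mul (L u2) (T u2) a2 b2 f) =
    \sum_s \sum_t L u1 a1 s (L u2 a2 t (T u1 s b1 (T u2 t b2 f))).
  rewrite !opmx_mulE; apply: eq_bigr => s _.
  rewrite (linear_pred_sum (T_linear _ _ _)) (linear_pred_sum (L_linear _ _ _)).
  by apply: eq_bigr => t _; rewrite -LT_comm.
(* The mixed terms [G] of the two commutators cancel. *)
pose G s t := L v c s (L u a t (T u s b (T v t d f))).
transitivity (\sum_s \sum_t
    (L u c s (L v a t (T u s b (T v t d f))) - G s t)
  + \sum_s \sum_t (G t s - L v c t (L u a s (T v t b (T u s d f))))).
  rewrite !mulE [X in _ *: (_ - X)]exchange_big -sumrB scaler_sumr -big_split.
  apply: eq_bigr => s _; rewrite -sumrB scaler_sumr -big_split.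
  apply: eq_bigr => t _ /=; rewrite /G -L_rtt.
  rewrite -!(linear_predB (L_linear _ _ _)) -T_rtt.
  rewrite !(linear_predZ (L_linear _ _ _)) !(linear_predB (L_linear _ _ _)).
  by rewrite -scalerDr addrA subrK.
rewrite !mulE [X in _ + X]exchange_big -big_split -sumrB.
apply: eq_bigr => s _; rewrite -big_split -sumrB.
by apply: eq_bigr => t _; rewrite /= addrA subrK.
Qed.

End Coproduct.

Lemma sum2 (V : nmodType) (F : 'I_2 -> V) : \sum_c F c = F 0 + F 1.
Proof.
rewrite !big_ord_recl big_ord0 addr0; congr (_ + F _).
exact: val_inj.
Qed.

(** One step on the first column of a product: the tail sends the vacuum to [y *: v] in the upper
    entry and to 0 in the lower one. *)
Lemma triangular_action (K : fieldType) (V : lmodType K) (f g : V -> V) v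
    (x y : K) : linear f -> linear g -> f v = x *: v ->
  f (y *: v) + g 0 = (x * y) *: v.
Proof.
move=> f_lin g_lin fv; rewrite (linear_predZ f_lin) (linear_pred0 g_lin) fv.
by rewrite addr0 scalerA mulrC.
Qed.

(** * Ordered products of local matrices over lists of sites *)

Section Monodromy.
Variables (R : realType) (I : eqType) (n : nat).
Variables (L : I -> R[i] -> 'M[operator R n]_2).
Implicit Types (r : seq I) (u v : R[i]) (a b c d : 'I_2).
Hypothesis L_linear : forall i u a b, linear (L i u a b).
Hypothesis L_comm : forall i j u v a b c d f, i != j ->
  L i u a b (L j v c d f) = L j v c d (L i u a b f).
Hypothesis L_rtt : forall i, rtt (L i).

Definition opmx_prod r u : 'M[operator R n]_2 :=
  \big[opmx_mul/opmx1]_(i <- r) L i u.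

Lemma opmx_prod_nil u a b f : opmx_prod [::] u a b f = if a == b then f else 0.
Proof. by rewrite /opmx_prod big_nil mxE; elim/ord2: a; elim/ord2: b. Qed.

Lemma opmx_prod_cons i r u :
  opmx_prod (i :: r) u = opmx_mul (L i u) (opmx_prod r u).
Proof. exact: big_cons. Qed.

Lemma opmx_prod_linear r u a b : linear (opmx_prod r u a b).
Proof.
elim: r u a b => [|i r IHr] u a b.
  move=> x f g; rewrite !opmx_prod_nil.
  by case: (a == b); rewrite ?scaler0 ?addr0.
rewrite opmx_prod_cons; exact: (opmx_mul_linear (L_linear i) IHr).
Qed.

Lemma opmx_prod_comm i r u v a b c d f : i \notin r ->
  L i u a b (opmx_prod r v c d f) = opmx_prod r v c d (L i u a b f).
Proof.
elim: r c d f => [|j r IHr] c d f.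
  rewrite !opmx_prod_nil => _; case: (c == d) => //.
  exact: linear_pred0 (L_linear _ _ _ _).
rewrite inE negb_or => /andP[ij ir].
rewrite opmx_prod_cons !opmx_mulE (linear_pred_sum (L_linear i u a b)).
by apply: eq_bigr => t _; rewrite L_comm ?IHr.
Qed.

Lemma opmx_prod_rtt r : uniq r -> rtt (opmx_prod r).
Proof.
elim: r => [_|i r IHr /= /andP[ir r_uniq]] u v a b c d f.
  rewrite !opmx_prod_nil.
  rewrite [RHS]subrr; case: (a == b); case: (c == d);
    by rewrite subrr scaler0.
rewrite !opmx_prod_cons.
apply: (@rtt_opmx_mul R n (L i) (opmx_prod r)) => //.
- exact: opmx_prod_linear.
- by move=> *; apply: opmx_prod_comm.
- exact: IHr.
Qed.

Variables (vac : formal_fun R n) (alpha delta : I -> R[i] -> R[i]).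
Hypothesis L11_vac : forall i u, L i u 0 0 vac = alpha i u *: vac.
Hypothesis L21_vac : forall i u, L i u 1 0 vac = 0.
Hypothesis L22_vac : forall i u, L i u 1 1 vac = delta i u *: vac.

(** On the vacuum each local matrix is upper triangular, so the upper left entries multiply; both
    entries of the column are needed in the induction. *)
Lemma opmx_prod_vacuum_col0 r u :
  opmx_prod r u 1 0 vac = 0 /\
  opmx_prod r u 0 0 vac = (\prod_(i <- r) alpha i u) *: vac.
Proof.
elim: r => [|i r [IH10 IH00]].
  by rewrite !opmx_prod_nil big_nil scale1r.
rewrite opmx_prod_cons big_cons; split; rewrite opmx_mulE sum2 IH10 IH00.
  have L21_scale : L i u 1 0 vac = 0 *: vac by rewrite L21_vac scale0r.
  have := triangular_action (\prod_(j <- r) alpha j u) (L_linear i u 1 0)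
    (L_linear i u 1 1) L21_scale.
  by rewrite mul0r scale0r.
exact: (triangular_action _ (L_linear i u 0 0) (L_linear i u 0 1)
  (L11_vac i u)).
Qed.

Lemma opmx_prod_vacuum11 r u : uniq r ->
  opmx_prod r u 1 1 vac = (\prod_(i <- r) delta i u) *: vac.
Proof.
elim: r => [|i r IHr /= /andP[ir r_uniq]].
  by rewrite opmx_prod_nil big_nil scale1r.
(* [L i u 1 0] commutes past [opmx_prod r u 0 1] and kills the vacuum. *)
rewrite opmx_prod_cons opmx_mulE sum2 opmx_prod_comm // L21_vac.
rewrite (linear_pred0 (opmx_prod_linear _ _ _ _)) add0r IHr //.
by rewrite (linear_predZ (L_linear _ _ _ _)) L22_vac scalerA mulrC big_cons.
Qed.

End Monodromy.

(** * Exchange relations contained in [rtt] *)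

Section ExchangeRelations.
Variables (R : realType) (n : nat) (T : R[i] -> 'M[operator R n]_2).
Hypothesis T_rtt : rtt T.
Implicit Types (u v : R[i]).

Lemma T12_comm u v f : T u 0 1 (T v 0 1 f) = T v 0 1 (T u 0 1 f).
Proof.
have two_neq0 : 2%:R != 0 :> R[i] by rewrite Num.Theory.pnatr_eq0.
exact: (eq_from_commutators two_neq0 (T_rtt u v 0 1 0 1 f)
  (T_rtt v u 0 1 0 1 f)).
Qed.

Lemma T11_T12_exchange u v f : u != v ->
  T u 0 0 (T v 0 1 f) =
  ((u - v + 1) / (u - v)) *: T v 0 1 (T u 0 0 f)
  - (1 / (u - v)) *: T u 0 1 (T v 0 0 f).
Proof.
(* [rtt] is used with [T v 0 1] as first factor; in the opposite order its right side would have the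
   diagonal entries to the left of the [T12] entries. *)
by move=> uv; exact: (exchange_from_opp_commutator uv (T_rtt v u 0 1 0 0 f)).
Qed.

Lemma T22_T12_exchange u v f : u != v ->
  T u 1 1 (T v 0 1 f) =
  ((u - v + -1) / (u - v)) *: T v 0 1 (T u 1 1 f)
  - (-1 / (u - v)) *: T u 0 1 (T v 1 1 f).
Proof.
by move=> uv; exact: (exchange_from_neg_commutator uv (T_rtt u v 1 1 0 1 f)).
Qed.

End ExchangeRelations.

(** * The monodromy matrix and its pseudo-vacuum *)

Section LaxMonodromy.
Variables (R : realType) (n : nat) (w : 'I_n -> R).
Implicit Types (i : 'I_n) (u : R[i]).
Local Notation vac := (pseudo_vacuum w).
Local Notation L := (fun i => lax w (rev_ord i)).

Lemma monodromy_linear u a b : linear (monodromy w u a b).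
Proof.
apply: (@opmx_prod_linear R 'I_n n L) => i; exact: lax_linear.
Qed.

Let L_comm i j u v a b c d f : i != j ->
  L i u a b (L j v c d f) = L j v c d (L i u a b f).
Proof. by move=> ij; apply: lax_comm; rewrite (inj_eq rev_ord_inj). Qed.

Lemma monodromy_rtt : rtt (monodromy w).
Proof.
apply: (@opmx_prod_rtt R 'I_n n L); last exact: index_enum_uniq.
- by move=> i; apply: lax_linear.
- exact: L_comm.
- by move=> i; apply: lax_rtt.
Qed.

Hypothesis w_neq0 : forall i, w i != 0.

Let wC_neq0 i : (w i)%:C != 0.
Proof. by rewrite fmorph_eq0. Qed.

(** The pseudo-vacuum is a single monomial and an off-diagonal entry shifts its exponent, hence the
    alternative [x = 0]. The coefficient is evaluated at the exponent of the resulting monomial. *)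
Lemma lax_pseudo_vacuum_eq i u a b (x : R[i]) :
  lax_coef w i u a b (- ((w i)%:C)^-1 - (b%:R - a%:R)) = x -> a = b \/ x = 0 ->
  lax w i u a b vac = x *: vac.
Proof.
move=> coefE ab; apply/malgP => k; rewrite mcoeff_lax mcoeffZ.
rewrite /pseudo_vacuum !mcoeffU.
have -> : (k 0 i)%:C = ((k + lax_shift R i a b) 0 i)%:C - (b%:R - a%:R).
  by rewrite lax_coord_shift addrK.
case: eqP => [vacE|vac_neq].
  rewrite -{1}vacE mxE rmorphN fmorphV coefE; case: ab => [ab|->].
    by move: vacE; rewrite ab lax_shift_diag addr0 => <-; rewrite eqxx.
  by rewrite !mul0r.
rewrite mulr0; case: ab => [ab|->]; last by rewrite mul0r.
move: vac_neq; rewrite ab lax_shift_diag addr0 => /eqP/negPf ->.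
by rewrite mulr0.
Qed.

Lemma lax_pseudo_vacuum00 i u :
  lax w i u 0 0 vac = (u + ((w i)%:C)^-1) *: vac.
Proof.
by apply: lax_pseudo_vacuum_eq; [rewrite /lax_coef /= subrr subr0 opprK | left].
Qed.

Lemma lax_pseudo_vacuum10 i u : lax w i u 1 0 vac = 0.
Proof.
rewrite -[RHS](scale0r vac); apply: lax_pseudo_vacuum_eq; last by right.
by rewrite /lax_coef /= mulr0n mulr1n; field; exact: wC_neq0.
Qed.

Lemma lax_pseudo_vacuum11 i u :
  lax w i u 1 1 vac = ((w i)%:C * ((w i)%:C * u - 1)) *: vac.
Proof.
apply: lax_pseudo_vacuum_eq; last by left.
by rewrite /lax_coef /= subrr; field; exact: wC_neq0.
Qed.

Lemma T11_vacuum u : T11 w u vac = vac_a w u *: vac.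
Proof.
(* The monodromy runs through the sites in decreasing order. *)
rewrite /vac_a (reindex_inj rev_ord_inj).
exact: (opmx_prod_vacuum_col0 (fun i => lax_linear w (rev_ord i))
  (fun i => lax_pseudo_vacuum00 (rev_ord i))
  (fun i => lax_pseudo_vacuum10 (rev_ord i)) (index_enum 'I_n) u).2.
Qed.

Lemma T22_vacuum u : T22 w u vac = vac_d w u *: vac.
Proof.
rewrite /vac_d (reindex_inj rev_ord_inj).
apply: (@opmx_prod_vacuum11 R 'I_n n L _ _ vac
  (fun i u => (w (rev_ord i))%:C * ((w (rev_ord i))%:C * u - 1))).
- by move=> i; apply: lax_linear.
- exact: L_comm.
- by move=> i v; apply: lax_pseudo_vacuum10.
- by move=> i v; apply: lax_pseudo_vacuum11.
- exact: index_enum_uniq.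
Qed.

End LaxMonodromy.

(** The Bethe equation is multiplied by [vac_d] and by the product on the left; the nonvanishing
    conditions in [bethe_equations] justify both cancellations. *)
Lemma bethe_equations_cross (R : realType) (n m : nat) (Q : R) (w : 'I_n -> R)
    (mu : 'I_m -> R[i]) (i : 'I_m) : bethe_equations Q w mu ->
  vac_a w (mu i) * \prod_(j | j != i) ((mu i - mu j + 1) / (mu i - mu j)) =
  Q%:C * (vac_d w (mu i) *
          \prod_(j | j != i) ((mu i - mu j + -1) / (mu i - mu j))).
Proof.
move=> /(_ i)[d_neq0 mu_neq0 /(congr1 ( *%R^~ (vac_d w (mu i))))].
rewrite divfK // => ->.
rewrite -!mulrA; congr (_ * _); rewrite mulrCA; congr (_ * _).
rewrite -big_split; apply: eq_bigr => j ji /=.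
by rewrite mulrA divfK ?mu_neq0.
Qed.

Theorem theorem3p13 (R : realType) (n m : nat) (Q : R) (w : 'I_n -> R)
    (mu : 'I_m -> R[i])
    (w_neq0 : forall i : 'I_n, w i != 0)
    (mu_distinct : injective mu)
    (mu_bethe : bethe_equations Q w mu) :
  forall u : R[i], (forall j : 'I_m, u != mu j) ->
    transfer Q w u (bethe_vector w mu) =
    bethe_eigenvalue Q w mu u *: bethe_vector w mu.
Proof.
(* The abstract ansatz works with a duplicate-free list of roots; injectivity of [mu] translates
   between roots and indices. *)
move=> u u_neq_mu; pose s := map mu (enum 'I_m).
have s_uniq : uniq s by rewrite map_inj_uniq ?enum_uniq.
have us : u \notin s.
  by apply/mapP => -[j _ /eqP uj]; move: (u_neq_mu j); rewrite uj.
have -> : bethe_vector w mu = foldr (T12 w) (pseudo_vacuum w) s.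
  by rewrite foldr_map.
have prodE (P : pred R[i]) (F : R[i] -> R[i]) :
    \prod_(z <- s | P z) F z = \prod_(j | P (mu j)) F (mu j).
  by rewrite big_map big_enum_cond.
have -> : bethe_eigenvalue Q w mu u =
    vac_a w u * \prod_(z <- s) ((u - z + 1) / (u - z)) +
    Q%:C%C * vac_d w u * \prod_(z <- s) ((u - z - 1) / (u - z)).
  by rewrite !prodE.
apply: (algebraic_bethe_ansatz (fun v => monodromy_linear w v 0 1)
  (T12_comm (monodromy_rtt w)) (T11_T12_exchange (monodromy_rtt w))
  (T22_T12_exchange (monodromy_rtt w)) (T11_vacuum w_neq0) (T22_vacuum w_neq0)
  s_uniq us) => _ /mapP[i _ ->].
have prod_neqE (F : R[i] -> R[i]) :
    \prod_(z <- s | z != mu i) F z = \prod_(j | j != i) F (mu j).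
  by rewrite prodE; apply: eq_bigl => j; rewrite (inj_eq mu_distinct).
by rewrite !prod_neqE; exact: bethe_equations_cross.
Qed.
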